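(* Let $R$ be a polarized proof-structure which is $\wp_{\mathsf o}$-terminal. If $R\models\mathsf{ACC}_{\mathsf i/\mathsf o}$, then $R$ is sequential.
   Context: Graphs. A graph $G$ consists of finite disjoint sets $N(G)$ (nodes), $A(G)$ (arcs) and functions $\mathrm{tail},\mathrm{head}:A(G)\to N(G)$. An arc $a$ is a conclusion of $\mathrm{tail}(a)$ and a premise of $\mathrm{head}(a)$. $G$ is directed acyclic if it has no directed cycle. $\sharp S$ is the cardinality of $S$. Ground-structures. Write $\wp$ for par. A ground-structure is a graph whose nodes carry labels in $\{\mathtt{ax},\mathtt{cut},\mathtt 1,\bot,\otimes,\wp,!,?\mathtt d,?,\bullet\}$ with the following numbers of premises and conclusions: $\mathtt{ax}$: 0 premises, 2 conclusions; $\mathtt{cut}$: 2, 0; $\mathtt 1$ and $\bot$: 0, 1; $\otimes$ and $\wp$: 2, 1; $!$: 0 premises, at least 1 conclusion; $?\mathtt d$: 1, 1; $?$: any number $k\ge0$ of premises, 1 conclusion; $\bullet$: 1, 0. It is equipped with a total order on the set of premises of its $\bullet$ nodes (these arcs are the conclusions of the ground-structure), on the conclusions of each $!$ node, and on the premises of each $\otimes$ and $\wp$ node. The greatest conclusion of a $!$ node is its principal port, the others its auxiliary ports. Proof-structures. A proof-structure (of finite depth, inductively) is a pair $R=(\mathcal G_R,\mathrm{box}_R)$ where $\mathcal G_R$ is a ground-structure and $\mathrm{box}_R$ maps each $!$ node $n$ of $\mathcal G_R$ to a proof-structure $\mathrm{box}_R(n)$ (its box) whose ground-structure has as many conclusions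 as $n$, all the sets of nodes and arcs involved being pairwise disjoint. Write $R'\sqsubset R$ if $R'=\mathrm{box}_R(n)$ for some $!$ node $n$ of $\mathcal G_R$. $A(R)$ is the set of arcs of $R$, including those in boxes at all depths. Sequential proof-structures (induction on $\sharp A(R)$; the order of the conclusions is irrelevant). $R$ is $n$-sequential, for a node $n$ of $\mathcal G_R$, if there are sequential proof-structures $R_1,R_2$ (as needed) such that: $n$ is an $\mathtt{ax}$ (resp. $\mathtt 1$) node and $\mathcal G_R$ consists only of $n$, its conclusions and the $\bullet$ nodes below them; or $n$ is a $!$ node, $\mathcal G_R$ consists only of $n$, its conclusions and the $\bullet$ nodes below them, and $\mathrm{box}_R(n)=R_1$; or $n$ is a $\mathtt{cut}$ (resp. $\otimes$) node and $R$ is obtained from the disjoint union of $R_1$ and $R_2$ by making one conclusion of $R_1$ and one conclusion of $R_2$ the two premises of $n$ (removing the two $\bullet$ nodes), the conclusion of $n$, if any, being a conclusion of $R$; or $n$ is a $\bot$ (resp. $\wp$, $?\mathtt d$, $?$) node whose conclusion is a conclusion of $R$, and $R$ is obtained from $R_1$ by adding $n$ with $0$ (resp. two, one, $k\ge 0$) conclusions of $R_1$ as its premises (removing the corresponding $\bullet$ nodes). $R$ is sequential if it is $n$-sequential for some node $n$. Polarization. A ground-structure is polarized if its arcs are labelled $\mathsf i$ (input) or $\mathsf o$ (output) so that: $\mathtt{ax}$ nodes have one input and one output conclusion; $\mathtt{cut}$ nodes have one input and one output premise; conclusions of $\mathtt 1$ nodes are output, of $\bot$ nodes input; the principal port of a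 $!$ node is output, its auxiliary ports input; the conclusion of a $?\mathtt d$ node is input (its premise is arbitrary); premises and conclusion of a $?$ node are input; for $\otimes$: either both premises and the conclusion are output, or exactly one premise is input and the conclusion is input; for $\wp$: either both premises and the conclusion are input, or exactly one premise is input and the conclusion is output; premises of $\bullet$ nodes are arbitrary. A $?\mathtt d$ node is classical if its premise is output; a $\bullet$ node is output if its premise is output; $\mathsf d_{\mathsf c}(\mathcal G)$, $\mathsf o(\mathcal G)$ denote the sets of classical $?\mathtt d$ nodes and of output $\bullet$ nodes. A $\wp_{\mathsf o}$ node is a $\wp$ node with output conclusion. $\mathcal G$ is $\wp_{\mathsf o}$-terminal if the conclusion of every $\wp_{\mathsf o}$ node is a premise of a $\wp_{\mathsf o}$ node or of a $\bullet$ node. The graph $\mathcal G^{\mathsf i/\mathsf o}$ is obtained from $\mathcal G$ by erasing the input premise of every $\wp_{\mathsf o}$ node and reversing the orientation of every input arc. $\mathcal G\models\mathsf{ACC}_{\mathsf i/\mathsf o}$ if $\mathcal G^{\mathsf i/\mathsf o}$ is directed acyclic and $\sharp\mathsf d_{\mathsf c}(\mathcal G)+\sharp\mathsf o(\mathcal G)=1$. A proof-structure $R$ is polarized (resp. $\wp_{\mathsf o}$-terminal; satisfies $\mathsf{ACC}_{\mathsf i/\mathsf o}$) if $\mathcal G_R$ is (resp. is; does) and, inductively, so is (does) every $R'\sqsubset R$. *)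

(* Defs.v *)
From HB Require Import structures.
From mathcomp Require Import all_boot.

Set Implicit Arguments.
Unset Strict Implicit.
Unset Printing Implicit Defensive.

(** * Graphs *)

Record graph := Graph {
  node : finType;
  arc : finType;
  tail : arc -> node;
  head : arc -> node
}.

Definition prems (G : graph) (n : node G) : {set arc G} := [set a | head a == n].
Definition concls (G : graph) (n : node G) : {set arc G} := [set a | tail a == n].

(** A directed cycle is a nonempty closed sequence of consecutive arcs. *)
Definition directed_acyclic (G : graph) : Prop :=
  forall c : seq (arc G), cycle (fun a b => head a == tail b) c -> c = [::].

(** * Ground-structures *)

(** [Der] is "?d", [Whynot] is "?". *)
Inductive label :=
  Ax | Cut | One | Bot | Tensor | Par | Bang | Der | Whynot | Bullet.

Lemma label_comparable : comparable label.
Proof. by rewrite /comparable /decidable; decide equality. Defined.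
Definition label_eqMixin := comparableMixin label_comparable.
HB.instance Definition _ := label_eqMixin.

(** [p] is the number of premises, [c] the number of conclusions. *)
Definition arity (l : label) (p c : nat) : bool :=
  match l with
  | Ax => (p == 0) && (c == 2)
  | Cut => (p == 2) && (c == 0)
  | One | Bot => (p == 0) && (c == 1)
  | Tensor | Par => (p == 2) && (c == 1)
  | Bang => (p == 0) && (0 < c)
  | Der => (p == 1) && (c == 1)
  | Whynot => c == 1
  | Bullet => (p == 1) && (c == 0)
  end.

Definition total_order_on (T : finType) (D : {set T}) (r : rel T) : Prop :=
  [/\ {in D, reflexive r}, {in D &, antisymmetric r},
      {in D & &, transitive r} & {in D &, total r}].

(** The values of the three order relations outside the sets mentioned in
    [concl_leP], [bang_leP] and [prem_leP] are irrelevant. *)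
Record ground := Ground {
  ground_graph :> graph;
  lab : node ground_graph -> label;
  concl_le : rel (arc ground_graph);
  bang_le : node ground_graph -> rel (arc ground_graph);
  prem_le : node ground_graph -> rel (arc ground_graph);
  labP : forall n, arity (lab n) #|prems n| #|concls n|;
  concl_leP : total_order_on [set a | lab (head a) == Bullet] concl_le;
  bang_leP : forall n, lab n = Bang -> total_order_on (concls n) (bang_le n);
  prem_leP : forall n, lab n = Tensor \/ lab n = Par ->
    total_order_on (prems n) (prem_le n)
}.

Definition conclusions (G : ground) : {set arc G} :=
  [set a | lab (head a) == Bullet].

Definition bang (G : ground) := {n : node G | lab n == Bang}.

Definition principal (G : ground) (n : node G) (a : arc G) : bool :=
  (a \in concls n) && [forall b in concls n, bang_le n b a].

(** * Proof-structures *)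

(** Nodes and arcs of different boxes live in different types, which accounts
    for the disjointness requirement; finite depth comes from the induction.
    The constraint on the number of conclusions of the boxes is imposed by
    [proof_structure] below. *)
Inductive pstruct := PStruct (G : ground) (b : bang G -> pstruct).

Definition ground_of (R : pstruct) : ground := let: PStruct G _ := R in G.
Coercion ground_of : pstruct >-> ground.

Definition box (R : pstruct) : bang R -> pstruct :=
  match R return bang R -> pstruct with PStruct _ b => b end.

Fixpoint proof_structure (R : pstruct) : Prop :=
  let: PStruct G b := R in
  forall n : bang G,
    #|conclusions (b n)| = #|concls (val n)| /\ proof_structure (b n).

Fixpoint all_arcs (R : pstruct) : Type :=
  let: PStruct G b := R in (arc G + {n : bang G & all_arcs (b n)})%type.

(** * Sequential proof-structures *)

(** The ground-structure consists only of [n], its conclusions and the bullets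
    below them. *)
Definition only (G : ground) (n : node G) : Prop :=
  (forall a : arc G, tail a = n) /\
  (forall m : node G, m = n \/
     lab m = Bullet /\ exists2 a : arc G, tail a = n & head a = m).

(** [extension n S]: up to renaming of nodes and arcs, [R] is obtained from the
    disjoint union of the proof-structures [S i] by adding the node [n], taking
    some conclusions of the [S i] as its premises, the conclusions of [n] being
    conclusions of [R].  Instead of being deleted, the bullets below the
    conclusions of the [S i] that become premises of [n] are sent to [n], so
    that the renaming is a graph morphism.  Orders on conclusions of
    proof-structures are deliberately not compared. *)
Record extension (R : pstruct) (n : node R) (I : Type) (S : I -> pstruct) := {
  ext_arc : forall i, arc (S i) -> arc R;
  ext_node : forall i, node (S i) -> node R;
  ext_tail : forall i (a : arc (S i)), tail (ext_arc a) = ext_node (tail a);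
  ext_head : forall i (a : arc (S i)), head (ext_arc a) = ext_node (head a);
  ext_arc_inj :
    injective (fun x : {i : I & arc (S i)} => ext_arc (tagged x));
  ext_arc_surj : forall a : arc R,
    tail a = n \/ exists i, exists b : arc (S i), a = ext_arc b;
  ext_node_inj : forall x y : {i : I & node (S i)},
    ext_node (tagged x) = ext_node (tagged y) ->
    ext_node (tagged x) <> n -> x = y;
  ext_node_surj : forall m : node R,
    [\/ m = n, (exists2 a : arc R, tail a = n & head a = m)
      | exists i, exists k : node (S i), m = ext_node k];
  ext_removed : forall i (k : node (S i)), ext_node k = n -> lab k = Bullet;
  ext_terminal : forall a : arc R, tail a = n -> lab (head a) = Bullet;
  ext_lab : forall i (k : node (S i)),
    ext_node k <> n -> lab (ext_node k) = lab k;
  ext_bang_le : forall i (k : node (S i)), lab k = Bang ->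
    {in concls k &, forall a b,
      bang_le (ext_node k) (ext_arc a) (ext_arc b) = bang_le k a b};
  ext_prem_le : forall i (k : node (S i)), lab k = Tensor \/ lab k = Par ->
    {in prems k &, forall a b,
      prem_le (ext_node k) (ext_arc a) (ext_arc b) = prem_le k a b};
  ext_box : forall i (k : bang (S i)) (m : bang R),
    val m = ext_node (val k) -> box m = box k
}.

(** The premises of [n] coming from [S i]. *)
Definition ext_prems (R : pstruct) (n : node R) (I : Type) (S : I -> pstruct)
    (E : extension n S) (i : I) : {set arc (S i)} :=
  [set a | head (ext_arc E a) == n].

(** [sequential_at n] is "n-sequential".  The number of conclusions of the
    single substructure that [seq_unary] uses as premises is the number of
    premises of [n] in [R], which the label of [n] constrains. *)
Inductive sequential_at : forall R : pstruct, node R -> Prop :=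
| seq_axiom (R : pstruct) (n : node R) :
    lab n = Ax \/ lab n = One -> only n -> sequential_at n
| seq_box (R : pstruct) (n : bang R) :
    only (val n) -> sequential (box n) -> sequential_at (val n)
| seq_binary (R : pstruct) (n : node R) (S : bool -> pstruct)
    (E : extension n S) :
    lab n = Cut \/ lab n = Tensor ->
    (forall i, #|ext_prems E i| = 1) ->
    (forall i, sequential (S i)) -> sequential_at n
| seq_unary (R : pstruct) (n : node R) (R1 : pstruct)
    (E : extension n (fun _ : unit => R1)) :
    [\/ lab n = Bot, lab n = Par, lab n = Der | lab n = Whynot] ->
    sequential R1 -> sequential_at n
with sequential : pstruct -> Prop :=
| Sequential (R : pstruct) (n : node R) :
    proof_structure R -> sequential_at n -> sequential R.

(** * Polarization *)

Inductive polarity := Input | Output.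

Lemma polarity_comparable : comparable polarity.
Proof. by rewrite /comparable /decidable; decide equality. Defined.
Definition polarity_eqMixin := comparableMixin polarity_comparable.
HB.instance Definition _ := polarity_eqMixin.

Section GroundPolarity.
Variables (G : ground) (p : arc G -> polarity).

Definition inputs (D : {set arc G}) : {set arc G} := [set a in D | p a == Input].
Definition outputs (D : {set arc G}) : {set arc G} := [set a in D | p a == Output].

Definition ground_polarized : Prop :=
  forall n : node G,
  match lab n with
  | Ax => #|inputs (concls n)| = 1 /\ #|outputs (concls n)| = 1
  | Cut => #|inputs (prems n)| = 1 /\ #|outputs (prems n)| = 1
  | One => {in concls n, forall a, p a = Output}
  | Bot => {in concls n, forall a, p a = Input}
  | Tensor =>
      {in prems n, forall a, p a = Output} /\
      {in concls n, forall a, p a = Output}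
      \/ #|inputs (prems n)| = 1 /\ {in concls n, forall a, p a = Input}
  | Par =>
      {in prems n, forall a, p a = Input} /\
      {in concls n, forall a, p a = Input}
      \/ #|inputs (prems n)| = 1 /\ {in concls n, forall a, p a = Output}
  | Bang =>
      {in concls n, forall a, p a = if principal n a then Output else Input}
  | Der => {in concls n, forall a, p a = Input}
  | Whynot =>
      {in prems n, forall a, p a = Input} /\
      {in concls n, forall a, p a = Input}
  | Bullet => True
  end.

Definition classical_der : {set node G} :=
  [set n | (lab n == Der) && [exists a in prems n, p a == Output]].

Definition output_bullets : {set node G} :=
  [set n | (lab n == Bullet) && [exists a in prems n, p a == Output]].

Definition par_o (n : node G) : bool :=
  (lab n == Par) && [exists a in concls n, p a == Output].

Definition ground_par_o_terminal : Prop :=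
  forall a : arc G, par_o (tail a) -> par_o (head a) \/ lab (head a) = Bullet.

Definition io_kept (a : arc G) : bool := ~~ (par_o (head a) && (p a == Input)).

Definition io_graph : graph :=
  @Graph (node G) {a : arc G | io_kept a}
    (fun a => if p (val a) == Input then head (val a) else tail (val a))
    (fun a => if p (val a) == Input then tail (val a) else head (val a)).

Definition ground_ACC : Prop :=
  directed_acyclic io_graph /\ #|classical_der| + #|output_bullets| = 1.

End GroundPolarity.

(** [P] holds of the polarized ground-structure of [R] and of those of all its
    boxes, at all depths. *)
Fixpoint hereditarily (P : forall G : ground, (arc G -> polarity) -> Prop)
    (R : pstruct) : (all_arcs R -> polarity) -> Prop :=
  match R return (all_arcs R -> polarity) -> Prop with
  | PStruct G b => fun p =>
      P G (fun a => p (inl a)) /\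
      forall n : bang G, hereditarily P (fun a => p (inr (existT _ n a)))
  end.

Definition polarized (R : pstruct) (p : all_arcs R -> polarity) : Prop :=
  hereditarily ground_polarized p.

Definition par_o_terminal (R : pstruct) (p : all_arcs R -> polarity) : Prop :=
  hereditarily ground_par_o_terminal p.

Definition ACC (R : pstruct) (p : all_arcs R -> polarity) : Prop :=
  hereditarily ground_ACC p.

(* Main.v *)
From mathcomp Require Import all_boot.
Require Import Defs.

Set Implicit Arguments.
Unset Strict Implicit.
Unset Printing Implicit Defensive.

(** The edges of G^{i/o} that are kept strictly increase some rank on nodes.
    If some par, ?d, ? or bot node has its conclusion among those of G,
    remove it. Otherwise par_o-terminality excludes par_o nodes, and any
    other par, ?d, ? or bot node has an upstream cut or tensor node with
    an input premise. Take such a node n of minimal rank, or, if there is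
    none, the node above the unique output conclusion. All nodes of
    smaller rank then have at most one outgoing edge in G^{i/o}, so the
    nodes upstream of an output premise a of n meet the rest of G only
    along a, which splits G at n; when n is an ax, 1 or ! node, there is
    nothing else in G. *)

(** * Finite graphs, total orders and node arities *)

(** The rank of a node is the number of nodes from which it can be reached. Along [a] this set
    grows, and strictly: if [head a] reached [tail a], the arc [a] would close a cycle. *)
Lemma acyclic_rank (G : graph) : directed_acyclic G ->
  exists r : node G -> nat, forall a : arc G, r (tail a) < r (head a).
Proof.
move=> acG.
pose e (x y : node G) := [exists a : arc G, (tail a == x) && (head a == y)].
(* Lifts a path of nodes to a sequence of arcs. Stating it between two outer arcs [a] and [b] allows
   [a = b] below, which turns the sequence into a cycle. *)
have arcs_of q x : path e x q -> exists c : seq (arc G),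
    forall a b : arc G, head a = x -> tail b = last x q ->
    path (fun a b => head a == tail b) a (rcons c b).
  elim: q x => [|y q IHq] x /=.
    by move=> _; exists [::] => a b /= -> ->; rewrite eqxx.
  case/andP=> /existsP[d /andP[/eqP dx /eqP dy]] /IHq[c Hc].
  exists (d :: c) => a b ax bl /=; rewrite ax dx eqxx /=.
  exact: Hc.
exists (fun x => #|[set y | connect e y x]|) => a; apply/proper_card/properP; split.
  apply/subsetP=> y; rewrite !inE => /connect_trans; apply.
  by apply/connect1/existsP; exists a; rewrite !eqxx.
exists (head a); rewrite inE ?connect0 //; apply/negP=> /connectP[q q_path q_last].
have [c Hc] := arcs_of _ _ q_path.
by have := acG (a :: c) (Hc a a erefl q_last).
Qed.

Lemma total_order_enum_rank (T : finType) (D : {set T}) :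
  total_order_on D (fun a b => enum_rank a <= enum_rank b).
Proof.
split.
- by move=> a _; apply: leqnn.
- by move=> a b _ _ /anti_leq/val_inj/enum_rank_inj.
- by move=> b a c _ _ _; apply: leq_trans.
- by move=> a b _ _; apply: leq_total.
Qed.

(** An element with the most elements below it is greatest: anything above it has at least the same
    lower set, hence by maximality exactly the same one. *)
Lemma total_order_max (T : finType) (D : {set T}) (le : rel T) :
  total_order_on D le -> (exists x, x \in D) -> exists2 x, x \in D & {in D, forall y, le y x}.
Proof.
case=> le_refl _ le_trans le_total [x0 x0D].
pose below x := [set y in D | le y x].
case: (@arg_maxnP _ x0 (mem D) (fun x => #|below x|) x0D) => x xD x_max.
exists x => // y yD; have /orP[//|xy] := le_total _ _ yD xD.
have below_xy : below x \subset below y.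
  apply/subsetP=> z; rewrite !inE => /andP[zD zx]; rewrite zD /=.
  exact: (le_trans x).
have : below x == below y by rewrite eqEcard below_xy; apply: x_max.
by move/eqP/setP/(_ y); rewrite !inE yD le_refl // => ->.
Qed.

Lemma prem_unique (G : ground) (e f : arc G) : lab (head e) \in [:: Der; Bullet] ->
  head f = head e -> f = e.
Proof.
move=> l fe; have: #|prems (head e)| <= 1.
  by have := labP (head e); move: l; case: (lab _) => // _ /andP[/eqP->].
by move/card_le1_eqP; apply; rewrite inE ?fe.
Qed.

Lemma tail_bullet (G : ground) (e : arc G) : lab (tail e) <> Bullet.
Proof.
move=> te; have := labP (tail e); rewrite te => /andP[_].
by rewrite cards_eq0 => /eqP/setP/(_ e); rewrite !inE eqxx.
Qed.

Lemma bullet_prem (G : ground) (e f : arc G) :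
  lab (head e) = Bullet -> head f = head e -> f = e.
Proof. by move=> eb; apply: prem_unique; rewrite eb. Qed.

Lemma concl_unique (G : ground) (e f : arc G) : lab (tail e) \notin [:: Ax; Bang] ->
  tail f = tail e -> f = e.
Proof.
move=> l fe; have: #|concls (tail e)| <= 1.
  have := labP (tail e); have := @tail_bullet G e; move: l.
  case: (lab _) => //= _ _; try by [move/eqP-> | case/andP=> _ /eqP->].
by move/card_le1_eqP; apply; rewrite inE ?fe.
Qed.

Lemma two_prems (G : ground) (n : node G) (a : arc G) : #|prems n| = 2 -> head a = n ->
  exists f, f != a /\ prems n = [set a; f].
Proof.
move=> n2 an; have: #|prems n :\ a| == 1.
  by have := cardsD1 a (prems n); rewrite inE an eqxx n2 => -[]; rewrite add0n => <-.
case/cards1P=> f nf; exists f; have: f \in prems n :\ a by rewrite nf inE.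
by rewrite !inE => /andP[-> _]; rewrite -nf setD1K // inE an.
Qed.

Lemma outputE (x : polarity) : x <> Input -> x = Output.
Proof. by case: x. Qed.

Lemma one_input (G : ground) (p : arc G -> polarity) (n : node G) :
  #|prems n| = 2 -> #|inputs p (prems n)| = 1 ->
  exists i o, [/\ p i = Input, p o = Output & prems n = [set i; o]].
Proof.
move=> n2 /eqP/cards1P[i ni]; have: i \in inputs p (prems n) by rewrite ni inE.
rewrite !inE => /andP[/eqP i_n /eqP ii]; have [o [oi no]] := two_prems n2 i_n.
exists i, o; split=> //; apply: outputE => oI.
have: o \in inputs p (prems n) by rewrite !(inE, no, oI) eqxx orbT.
by rewrite ni inE (negbTE oi).
Qed.

Lemma sequential_proof_structure (R : pstruct) : sequential R -> proof_structure R.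
Proof. by case. Qed.

(** * Consequences of the correctness criterion for one ground-structure *)

Section Polarity.
Variables (G : ground) (p : arc G -> polarity).

(** Acyclicity of [io_graph p] expressed by a rank, a form that is easy to carry over to
    substructures. *)
Definition ranked : Prop := exists r : node G -> nat, forall e : arc G,
  io_kept p e ->
  if p e == Input then r (head e) < r (tail e) else r (tail e) < r (head e).

(** Since ?d and bullet nodes have a single premise, these arcs are in bijection
    with the classical ?d nodes and the output bullets. *)
Definition goal_arc (e : arc G) : bool :=
  (p e == Output) && (lab (head e) \in [:: Der; Bullet]).

Definition intuitionistic : Prop := exists g, forall e, goal_arc e = (e == g).

Lemma ACC_ranked : ground_ACC p -> ranked.
Proof.
case=> /acyclic_rank[r rP] _; exists r => e ek.
by have := rP (exist _ e ek); rewrite /=; case: ifP.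
Qed.

Lemma ACC_intuitionistic : ground_ACC p -> intuitionistic.
Proof.
case=> _; pose goals := [set e | goal_arc e].
have goal_heads x : (x \in @head G @: goals) =
    (lab x \in [:: Der; Bullet]) && [exists e in prems x, p e == Output].
  apply/imsetP/andP => [[e]|[xl /exists_inP[e]]].
    rewrite inE => /andP[eo el] ->; split=> //; apply/exists_inP; exists e => //.
    by rewrite inE.
  by rewrite inE => /eqP ex eo; exists e; rewrite // inE /goal_arc ex eo xl.
have -> : #|classical_der p| + #|output_bullets p| = #|goals|.
  rewrite -(card_in_imset (f := @head G) (D := goals)); last first.
    by move=> e f; rewrite !inE => _ /andP[_ fl]; apply: prem_unique.
  rewrite -[RHS](cardsID [set x | lab x == Der]).
  congr addn; apply: eq_card => x; rewrite !(inE, goal_heads); case: (lab x) => //=.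
    by rewrite eqxx andbT.
  by rewrite (_ : Bullet == Der = false) ?andbF.
move/eqP/cards1P=> [g gP]; exists g => e.
by have /setP/(_ e) := gP; rewrite !inE.
Qed.

End Polarity.

(** * The substructure cut out by a set of nodes *)

Section Sub.
Variables (G : ground) (n : node G).

(** The arcs with exactly one end in [A] all go from [A] to [n]. Ending each of them in a new bullet
    makes [A] a ground-structure of its own. *)
Definition closed_off (A : {set node G}) : Prop :=
  [/\ n \notin A,
      forall e : arc G, tail e \in A -> (head e \in A) || (head e == n)
    & forall e : arc G, head e \in A -> tail e \in A].

Variable A : {set node G}.
Hypothesis A_closed : closed_off A.

Definition sub_arc := {e : arc G | tail e \in A}.

(** [inr e] is the bullet that terminates the premise [e] of [n] once [n] is gone. *)
Definition sub_node_pred (x : node G + arc G) : bool :=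
  match x with
  | inl m => m \in A
  | inr e => (tail e \in A) && (head e == n)
  end.

Definition sub_node := {x : node G + arc G | sub_node_pred x}.

Definition sub_tail (e : sub_arc) : sub_node := exist _ (inl (tail (val e))) (valP e).

Lemma sub_head_proof (e : sub_arc) :
  sub_node_pred (if head (val e) == n then inr (val e) else inl (head (val e))).
Proof.
case: A_closed => _ /(_ _ (valP e)) + _.
by case: (head (val e) == n) / boolP => [en _ | _]; rewrite /= ?(valP e) ?en // orbF.
Qed.

Definition sub_head (e : sub_arc) : sub_node := exist sub_node_pred _ (sub_head_proof e).

Definition sub_graph := @Graph sub_node sub_arc sub_tail sub_head.

(** New bullets are sent to [n], so that this is the node part of the graph morphism required by
    [extension]. *)
Definition sub_origin (x : sub_node) : node G :=
  match val x with inl m => m | inr _ => n end.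

Definition sub_lab (x : sub_node) : label :=
  match val x with inl m => lab m | inr _ => Bullet end.

Variant sub_node_spec (x : sub_node) : Prop :=
| SubOld of val x = inl (sub_origin x) & sub_origin x \in A & sub_origin x != n
| SubNew e of val x = inr e & tail e \in A & head e = n & sub_origin x = n.

Lemma sub_nodeP (x : sub_node) : sub_node_spec x.
Proof.
have := valP x; case x_def: (val x) => [m|e] /=.
  move=> mA; have o: sub_origin x = m by rewrite /sub_origin x_def.
  apply: SubOld; rewrite o //; case: A_closed => nA _ _.
  by apply: contraNneq nA => <-.
by case/andP=> eA /eqP en; apply: (SubNew x_def) => //; rewrite /sub_origin x_def.
Qed.

Lemma sub_labE x : sub_origin x != n -> sub_lab x = lab (sub_origin x).
Proof.
by case: (sub_nodeP x) => [h _ _ | e _ _ _ ->]; rewrite ?eqxx // /sub_lab h.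
Qed.

Lemma sub_lab_n x : sub_origin x = n -> sub_lab x = Bullet.
Proof.
by case: (sub_nodeP x) => [_ _ /eqP// | e h _ _ _]; rewrite /sub_lab h.
Qed.

Lemma sub_lab_old x : sub_lab x != Bullet -> sub_origin x != n.
Proof. by apply: contra => /eqP/sub_lab_n ->. Qed.

Lemma sub_tail_eq (e : arc sub_graph) (x : sub_node) :
  sub_origin x != n -> (tail e == x) = (tail (val e) == sub_origin x).
Proof.
case: (sub_nodeP x) => [h _ _ _ | e' _ _ _ ->]; last by rewrite eqxx.
by rewrite -val_eqE /= h.
Qed.

Lemma sub_head_eq (e : arc sub_graph) (x : sub_node) :
  sub_origin x != n -> (head e == x) = (head (val e) == sub_origin x).
Proof.
case: (sub_nodeP x) => [h _ xn _ | e' _ _ _ ->]; last by rewrite eqxx.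
rewrite -val_eqE /= h; case: (head (val e) =P n) => [->|//].
by rewrite [RHS]eq_sym (negbTE xn).
Qed.

Lemma sub_concls (x : node sub_graph) :
  sub_origin x != n -> val @: concls x = concls (sub_origin x).
Proof.
move=> xn; apply/setP=> e; rewrite inE; apply/imsetP/eqP => [[e' + ->]|ex].
  by rewrite inE sub_tail_eq // => /eqP.
have eA : tail e \in A by rewrite ex; case: (sub_nodeP x) xn => // ? _ _ _ ->; rewrite eqxx.
by exists (exist _ e eA); rewrite // inE sub_tail_eq //= ex.
Qed.

(** An old node loses no premise, since [A] contains the tail of every arc whose head it
    contains. *)
Lemma sub_prems (x : node sub_graph) :
  sub_origin x != n -> val @: prems x = prems (sub_origin x).
Proof.
move=> xn; apply/setP=> e; rewrite inE; apply/imsetP/eqP => [[e' + ->]|ex].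
  by rewrite inE sub_head_eq // => /eqP.
have eA : tail e \in A.
  case: A_closed => _ _; apply; rewrite ex.
  by case: (sub_nodeP x) xn => // ? _ _ _ ->; rewrite eqxx.
by exists (exist _ e eA); rewrite // inE sub_head_eq //= ex.
Qed.

Lemma sub_card_arcs (D : {set arc sub_graph}) (D' : {set arc G}) :
  val @: D = D' -> #|D| = #|D'|.
Proof. by move<-; rewrite card_imset //; apply: val_inj. Qed.

Lemma total_order_sub (D : {set arc sub_graph}) (D' : {set arc G}) (r : rel (arc G)) :
  val @: D = D' -> total_order_on D' r -> total_order_on D (fun a b => r (val a) (val b)).
Proof.
move=> <- [r1 r2 r3 r4]; split.
- by move=> a aD; apply: r1; apply: imset_f.
- by move=> a b aD bD h; apply/val_inj/r2 => //; apply: imset_f.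
- by move=> a b c aD bD cD; apply: r3; apply: imset_f.
- by move=> a b aD bD; apply: r4; apply: imset_f.
Qed.

Lemma sub_labP (x : node sub_graph) : arity (sub_lab x) #|prems x| #|concls x|.
Proof.
case: (sub_nodeP x) => [_ _ xn | e h eA en xn].
  by rewrite sub_labE // (sub_card_arcs (sub_prems xn)) (sub_card_arcs (sub_concls xn)) labP.
rewrite sub_lab_n //=.
have -> : prems x = [set (exist _ e eA : sub_arc)].
  apply/setP=> f; rewrite !inE -!val_eqE /= h; case: (head (val f) =P n) => [//|fn].
  by symmetry; apply/negbTE/eqP => fe; apply: fn; rewrite -en; congr head.
have -> : concls x = set0.
  by apply/setP=> f; rewrite !inE -val_eqE /= h.
by rewrite cards1 cards0.
Qed.

(** The orders at old nodes are inherited from [G], as [extension] demands. The order on conclusions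
    is an arbitrary one, because [extension] does not compare it. *)
Definition sub_ground : ground.
Proof.
refine (@Ground sub_graph sub_lab (fun a b => enum_rank a <= enum_rank b)
  (fun x a b => bang_le (sub_origin x) (val a) (val b))
  (fun x a b => prem_le (sub_origin x) (val a) (val b)) sub_labP _ _ _).
- exact: total_order_enum_rank.
- move=> x xl; have xn : sub_origin x != n by apply: sub_lab_old; rewrite xl.
  apply: (total_order_sub (sub_concls xn)); apply: bang_leP.
  by rewrite -sub_labE.
- move=> x xl; have xn : sub_origin x != n by apply: sub_lab_old; case: xl => ->.
  apply: (total_order_sub (sub_prems xn)); apply: prem_leP.
  by rewrite -sub_labE.
Defined.

Lemma sub_ground_lab (x : node sub_ground) :
  sub_origin x != n -> lab x = lab (sub_origin x).
Proof. exact: sub_labE. Qed.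

Lemma sub_ground_lab_n (x : node sub_ground) : sub_origin x = n -> lab x = Bullet.
Proof. exact: sub_lab_n. Qed.

Lemma sub_bang_proof (x : bang sub_ground) : lab (sub_origin (val x)) == Bang.
Proof.
have xl := valP x; rewrite -sub_ground_lab //; apply: sub_lab_old.
by rewrite [sub_lab _](eqP xl).
Qed.

Definition sub_bang (x : bang sub_ground) : bang G :=
  exist (fun m => lab m == Bang) _ (sub_bang_proof x).

Variable b : bang G -> pstruct.

Definition sub_pstruct : pstruct := @PStruct sub_ground (fun x => b (sub_bang x)).

Lemma sub_bang_old (x : bang sub_ground) : sub_origin (val x) != n.
Proof. by apply: sub_lab_old; rewrite [sub_lab _](eqP (valP x)). Qed.

Lemma sub_boxes (Q : pstruct -> Prop) :
  (forall m : bang G, #|conclusions (b m)| = #|concls (val m)| /\ Q (b m)) ->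
  forall x : bang sub_ground,
    #|conclusions (b (sub_bang x))| = #|concls (val x)| /\ Q (b (sub_bang x)).
Proof.
move=> bQ x; have [-> ?] := bQ (sub_bang x); split=> //.
by rewrite (sub_card_arcs (sub_concls (sub_bang_old x))).
Qed.

Variable p : arc G -> polarity.

Definition sub_pol (e : arc sub_ground) : polarity := p (val e).

Lemma sub_forall (D : {set arc sub_ground}) (D' : {set arc G}) (P : arc G -> Prop) :
  val @: D = D' -> {in D', forall e, P e} -> {in D, forall e, P (val e)}.
Proof. by move=> <- DP e eD; apply: DP; apply: imset_f. Qed.

Lemma sub_card_inputs (D : {set arc sub_ground}) (D' : {set arc G}) :
  val @: D = D' -> #|inputs sub_pol D| = #|inputs p D'|.
Proof.
move=> <-; apply: sub_card_arcs; apply/setP=> e.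
rewrite inE; apply/imsetP/andP => [[f + ->]|[/imsetP[f fD ->] fi]].
  by rewrite inE => /andP[fD fi]; rewrite imset_f.
by exists f; rewrite // inE fD.
Qed.

Lemma sub_card_outputs (D : {set arc sub_ground}) (D' : {set arc G}) :
  val @: D = D' -> #|outputs sub_pol D| = #|outputs p D'|.
Proof.
move=> <-; apply: sub_card_arcs; apply/setP=> e.
rewrite inE; apply/imsetP/andP => [[f + ->]|[/imsetP[f fD ->] fi]].
  by rewrite inE => /andP[fD fi]; rewrite imset_f.
by exists f; rewrite // inE fD.
Qed.

Lemma sub_principal (x : node sub_ground) (e : arc sub_ground) :
  sub_origin x != n -> principal x e = principal (sub_origin x) (val e).
Proof.
move=> xn; rewrite /principal -(sub_concls xn) mem_imset; last exact: val_inj.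
congr andb; apply/forall_inP/forall_inP => [H _ /imsetP[f fx ->]|H f fx].
  exact: (H f fx).
by apply: (H (val f)); rewrite imset_f.
Qed.

Lemma sub_polarized : ground_polarized p -> ground_polarized sub_pol.
Proof.
move=> pP x; case: (sub_nodeP x) => [_ _ xn | e _ _ _ xn]; last by rewrite sub_ground_lab_n.
have [cx qx] := (sub_concls xn, sub_prems xn).
rewrite sub_ground_lab //; have := pP (sub_origin x); case: (lab _) => //.
- by rewrite (sub_card_inputs cx) (sub_card_outputs cx).
- by rewrite (sub_card_inputs qx) (sub_card_outputs qx).
- exact: sub_forall cx.
- exact: sub_forall cx.
- case=> [[h1 h2]|[h1 h2]]; [left|right].
    by split; [apply: sub_forall qx h1|apply: sub_forall cx h2].
  by split; [rewrite (sub_card_inputs qx)|apply: sub_forall cx h2].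
- case=> [[h1 h2]|[h1 h2]]; [left|right].
    by split; [apply: sub_forall qx h1|apply: sub_forall cx h2].
  by split; [rewrite (sub_card_inputs qx)|apply: sub_forall cx h2].
- move=> h e ex; rewrite sub_principal //; exact: (sub_forall cx h).
- exact: sub_forall cx.
- by case=> h1 h2; split; [apply: sub_forall qx h1|apply: sub_forall cx h2].
Qed.

Lemma sub_par_o (x : node sub_ground) :
  sub_origin x != n -> par_o sub_pol x = par_o p (sub_origin x).
Proof.
move=> xn; rewrite /par_o sub_ground_lab // -(sub_concls xn).
congr andb; apply/exists_inP/exists_inP => [[e ex eo]|[_ /imsetP[e ex ->] eo]].
  by exists (val e); rewrite ?imset_f.
by exists e.
Qed.

Lemma sub_origin_head (e : arc sub_ground) : sub_origin (head e) = head (val e).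
Proof. by rewrite /sub_origin /=; case: eqP => [->|]. Qed.

Lemma sub_tail_n (e : arc sub_ground) : tail (val e) != n.
Proof. by case: A_closed => nA _ _; apply: contraNneq nA => <-; apply: (valP e). Qed.

Lemma sub_par_o_terminal : ground_par_o_terminal p -> ground_par_o_terminal sub_pol.
Proof.
move=> pT e; rewrite sub_par_o ?sub_tail_n // => /pT.
have [hn _|hn] := eqVneq (head (val e)) n.
  by right; rewrite sub_ground_lab_n // sub_origin_head.
by rewrite sub_par_o ?sub_ground_lab sub_origin_head.
Qed.

Lemma sub_ranked : ranked p -> ranked sub_pol.
Proof.
case=> r rP; pose M := \max_m r m.
have rM m : r m <= M by apply: leq_bigmax.
(* After reorientation, the new bullet of an input arc is a source and that of an output arc is a
   sink. Old ranks are shifted by one to leave 0 for the sources; [M.+2] exceeds all shifted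
   ranks. *)
exists (fun x : node sub_ground => match val x with
  | inl m => (r m).+1
  | inr e => if p e == Input then 0 else M.+2
  end) => e.
rewrite /io_kept /sub_pol /=; have [hn|hn] := eqVneq (head (val e)) n.
  by case: (p (val e) == Input) => //= _; rewrite !ltnS.
by rewrite sub_par_o ?sub_origin_head // => /rP; case: (p (val e) == Input).
Qed.

(** Output arcs from [A] into [n] become goal arcs, as they now end in a bullet. *)
Lemma sub_goalE (e : arc sub_ground) :
  goal_arc sub_pol e = (p (val e) == Output) &&
    ((head (val e) == n) || (lab (head (val e)) \in [:: Der; Bullet])).
Proof.
rewrite /goal_arc /sub_pol; congr andb.
have [hn|hn] := eqVneq (head (val e)) n.
  by rewrite sub_ground_lab_n ?sub_origin_head // inE.
by rewrite sub_ground_lab sub_origin_head.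
Qed.

End Sub.

(** * Reassembling a proof-structure from its parts *)

Section Extension.
Variables (G : ground) (b : bang G -> pstruct) (n : node G).
Variables (I : Type) (A : I -> {set node G}).
Hypothesis A_closed : forall i, closed_off n (A i).
Hypothesis A_disjoint : forall i j m, m \in A i -> m \in A j -> i = j.
Hypothesis A_cover : forall m, [\/ m = n, (exists2 e : arc G, tail e = n & head e = m)
  | exists i, m \in A i].
Hypothesis n_terminal : forall e : arc G, tail e = n -> lab (head e) = Bullet.

(** The embedding is [val] on arcs and [sub_origin] on nodes. The equation for [ext_arc] is kept in
    order to count the premises of [n] that come from each part. *)
Lemma sub_extension :
  exists E : extension (R := PStruct b) n (fun i => sub_pstruct (A_closed i) b),
    forall i (e : arc (sub_pstruct (A_closed i) b)), ext_arc E e = val e.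
Proof.
unshelve eexists.
- refine (@Build_extension (PStruct b) n I (fun i => sub_pstruct (A_closed i) b)
    (fun i e => val e) (fun i x => sub_origin x)
    _ _ _ _ _ _ _ _ _ _ _ _).
  + by [].
  + by move=> i e /=; rewrite sub_origin_head.
  + move=> [i e] [j f] /= ef.
    have ij : i = j by apply: (A_disjoint (valP e)); rewrite /= ef; exact: (valP f).
    by subst j; congr existT; apply: val_inj.
  + move=> e; have [-> | [f fn fe] | [i ei]] := A_cover (tail e); first by left.
      by case: (tail_bullet (e := e)); rewrite -fe n_terminal.
    by right; exists i, (exist _ e ei).
  + move=> [i x] [j y] /= xy xn.
    case: (sub_nodeP (A_closed i) x) => [hx xA _|e _ _ _ /xn//].
    case: (sub_nodeP (A_closed j) y) => [hy yA _|e _ _ _]; last by rewrite -xy => /xn.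
    have ij : i = j by apply: (A_disjoint xA); rewrite xy.
    by subst j; congr existT; apply: val_inj; rewrite hx hy xy.
  + move=> m; have [-> | fm | [i mi]] := A_cover m; first by constructor 1.
      by constructor 2.
    by constructor 3; exists i, (exist (@sub_node_pred G n (A i)) (inl m) mi).
  + by move=> i x; exact: sub_ground_lab_n.
  + exact: n_terminal.
  + by move=> i x /eqP xn; rewrite (sub_ground_lab (x := x)).
  + by [].
  + by [].
  + move=> i k m /= mk; congr (b _); apply: val_inj; exact: mk.
- by [].
Qed.

End Extension.

(** * Induction step: removing a terminal unary or binary node *)

Definition correct (G : ground) (p : arc G -> polarity) : Prop :=
  [/\ ground_polarized p, ground_par_o_terminal p, ranked p & intuitionistic p].

(** Three of the conditions pass to every closed-off set; the unique goal arc has to be supplied as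
    [g]. *)
Lemma sub_correct (G : ground) (p : arc G -> polarity) (n : node G) (A : {set node G})
    (A_closed : closed_off n A) (g : arc G) :
  correct p -> tail g \in A ->
  (forall e : arc G, tail e \in A ->
     (p e == Output) && ((head e == n) || (lab (head e) \in [:: Der; Bullet])) = (e == g)) ->
  correct (sub_pol (A_closed := A_closed) p).
Proof.
case=> p_pol p_term p_ranked _ gA gP; split.
- exact: sub_polarized.
- exact: sub_par_o_terminal.
- exact: sub_ranked.
- by exists (exist _ g gA) => e; rewrite sub_goalE gP ?(valP e).
Qed.

Section Step.
Variables (G : ground) (b : bang G -> pstruct) (p : arc G -> polarity).
Hypothesis p_correct : correct p.
Hypothesis b_boxes : forall m : bang G,
  #|conclusions (b m)| = #|concls (val m)| /\ sequential (b m).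
Hypothesis IH : forall (G' : ground) (b' : bang G' -> pstruct) (p' : arc G' -> polarity),
  #|arc G'| < #|arc G| -> correct p' ->
  (forall m : bang G', #|conclusions (b' m)| = #|concls (val m)| /\ sequential (b' m)) ->
  sequential (PStruct b').

Lemma boxes_proof_structure : proof_structure (PStruct b).
Proof. by move=> m; have [? /sequential_proof_structure] := b_boxes m. Qed.

(** The arc [e0] lies outside the part, so the number of arcs drops; [g] is the goal arc of the
    part. *)
Lemma sub_sequential (n : node G) (A : {set node G}) (A_closed : closed_off n A)
    (g e0 : arc G) : tail e0 \notin A -> tail g \in A ->
  (forall e : arc G, tail e \in A ->
     (p e == Output) && ((head e == n) || (lab (head e) \in [:: Der; Bullet])) = (e == g)) ->
  sequential (sub_pstruct A_closed b).
Proof.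
move=> e0A gA gP; apply: (IH _ (sub_correct A_closed p_correct gA gP)).
  rewrite card_sig; apply/proper_card/properP; split; first exact/subsetP.
  by exists e0.
exact: sub_boxes b_boxes.
Qed.

(** Since [c] is the only conclusion of [n], all nodes other than [n] and the bullet below [c] form
    a closed-off set. It remains to find its goal arc. *)
Lemma sequential_unary (c : arc G) :
  lab (tail c) \in [:: Par; Der; Whynot; Bot] -> lab (head c) = Bullet ->
  sequential (PStruct b).
Proof.
set n := tail c => nl cb.
have nc : lab n \notin [:: Ax; Bang] by case: (lab n) nl.
pose A := ~: [set n; head c].
have A_closed : closed_off n A.
  split=> [|e|e]; rewrite !inE ?eqxx // !negb_or.
    case/andP=> en _; case: eqP => //= _; rewrite orbF.
    by apply: contraNneq en => /(bullet_prem cb) ->.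
  move=> /andP[_ ec]; apply/andP; split.
    by apply: contraNneq ec => /(concl_unique nc) ->.
  by apply/eqP=> ec'; apply: (tail_bullet (e := e)); rewrite ec'.
have A_tail e : tail e != n -> tail e \in A.
  move=> en; rewrite !inE negb_or en.
  by apply/eqP=> ec; apply: (tail_bullet (e := e)); rewrite ec.
have [E _] : exists E : extension (R := PStruct b) n
    (fun _ : unit => sub_pstruct A_closed b), forall i e, ext_arc E (i := i) e = val e.
  apply: (sub_extension b (fun _ : unit => A_closed)) => [[] []//|m|e en].
    have [->|mn] := eqVneq m n; first by constructor 1.
    have [->|mc] := eqVneq m (head c); first by constructor 2; exists c.
    by constructor 3; exists tt; rewrite !inE negb_or mn mc.
  by rewrite (concl_unique nc en).
have [p_pol p_term p_ranked [g gP]] := p_correct.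
apply: (@Sequential (PStruct b) n); first exact: boxes_proof_structure.
apply: (seq_unary E); first by case: (lab n) nl => // _; constructor.
have nA : tail c \notin A by rewrite !inE eqxx.
suff [g' g'A g'P]: exists2 g' : arc G, tail g' \in A & forall e : arc G, tail e \in A ->
     (p e == Output) && ((head e == n) || (lab (head e) \in [:: Der; Bullet])) = (e == g').
  exact: sub_sequential nA g'A g'P.
have cn : c \in concls n by rewrite inE.
have nb : lab n != Bullet by apply/eqP/tail_bullet.
(* If [c] is output, then [n] is a par node with exactly one output premise [o]; [c] was the goal
   arc, and [o] takes its place. *)
have [co|/eqP co] := eqVneq (p c) Output.
  have : exists i o, [/\ p i = Input, p o = Output & prems n = [set i; o]].
    have := labP n; have := p_pol n; case: (lab n) nl => // _.
    - by move=> h; rewrite (h _ cn) in co.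
    - by case=> -[h1 h2] /andP[/eqP np _]; [rewrite (h2 _ cn) in co | apply: one_input].
    - by move=> h; rewrite (h _ cn) in co.
    - by case=> _ h; rewrite (h _ cn) in co.
  case=> i [o [ii oo /setP n_prems]].
  have /eqP on : head o == n by have := n_prems o; rewrite !inE eqxx orbT.
  have cg : c = g by apply/eqP; rewrite -gP /goal_arc co cb !inE.
  exists o.
    apply: A_tail; apply: contraTneq nb => /(concl_unique nc) oc.
    by rewrite -on oc cb.
  move=> e eA; have [-> | eo] := eqVneq e o; first by rewrite oo on !eqxx.
  apply/negbTE; apply/andP=> -[/eqP e_out]; case/orP=> [en|el].
    have := n_prems e; rewrite !inE en (negbTE eo) orbF => /esym/eqP ei.
    by rewrite ei ii in e_out.
  have : goal_arc p e by rewrite /goal_arc e_out el.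
  by rewrite gP -cg => /eqP ec; rewrite ec (negbTE nA) in eA.
(* If [c] is input, the goal arc stays: only a ?d node can then have an output premise, and that
   premise was a goal arc already. *)
exists g.
  apply: A_tail; apply/eqP=> /(concl_unique nc) gc; apply: co.
  by have := gP g; rewrite eqxx gc => /andP[/eqP].
move=> e _; rewrite -gP /goal_arc.
have [e_out|//] := eqVneq (p e) Output; have [en|//] := eqVneq (head e) n.
rewrite en; have {en} : e \in prems n by rewrite inE en.
have := labP n; have := p_pol n; case: (lab n) nl => // _.
- by move=> _ /andP[+ _]; rewrite cards_eq0 => /eqP->; rewrite inE.
- case=> -[h1 h2] _; first by move/h1; rewrite e_out.
  by case: co; apply: h2.
- by case=> h _ _ /h; rewrite e_out.
Qed.

(** The set [A] is one half, with [a] as its goal arc. The other half contains the second premise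
    [f] and needs a goal arc too. *)
Lemma sequential_binary (n : node G) (a : arc G) (A : {set node G}) :
  lab n = Cut \/ lab n = Tensor ->
  (forall e : arc G, tail e = n -> lab (head e) = Bullet) ->
  closed_off n A ->
  head a = n -> p a = Output -> tail a \in A ->
  (forall e : arc G, tail e \in A -> head e = n -> e = a) ->
  (forall e : arc G, tail e \in A -> ~~ goal_arc p e) ->
  sequential (PStruct b).
Proof.
move=> nl n_term A_closed an ao aA A_prem A_goal.
have [nA A_out A_in] := A_closed.
have [p_pol p_term p_ranked [g gP]] := p_correct.
have n2 : #|prems n| = 2 by have := labP n; case: nl => -> /andP[/eqP].
have [f [fa /setP n_prems]] := two_prems n2 an.
have /eqP fn : head f == n by have := n_prems f; rewrite !inE eqxx orbT.
have n_head e : tail e = n -> head e != n.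
  by move/n_term=> eb; apply/eqP=> en; case: nl; rewrite -en eb.
(* The other half: everything except [A], [n] and the bullet below [n], if any. *)
pose A' := [set m | [&& m \notin A, m != n &
                       [forall e : arc G, (tail e == n) ==> (head e != m)]]].
have A'P (e : arc G) : (tail e \in A') = (tail e \notin A) && (tail e != n).
  rewrite inE; case: (tail e \notin A) => //=; case: (tail e != n) => //=.
  apply/forall_inP=> e' /eqP/n_term e'b; apply/eqP=> ee.
  by apply: (tail_bullet (e := e)); rewrite -ee.
have A'_closed : closed_off n A'.
  split=> [|e|e]; first by rewrite inE eqxx andbF.
    rewrite A'P => /andP[eA en]; have [->|hn] := eqVneq (head e) n; first by rewrite orbT.
    rewrite orbF inE hn (contra (@A_in e)) //=.
    apply/forall_inP=> e' /eqP e'n; apply/eqP=> ee.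
    by rewrite (bullet_prem (n_term _ e'n) (esym ee)) e'n eqxx in en.
  rewrite A'P inE => /and3P[eA en /forall_inP he]; apply/andP; split.
    by apply: contra eA => /A_out; rewrite (negbTE en) orbF.
  by apply/eqP=> e_n; have := he e; rewrite e_n eqxx => /(_ isT) /eqP.
have fA' : tail f \in A'.
  rewrite A'P; apply/andP; split.
    by apply: contraNN fa => /A_prem/(_ fn) ->.
  by apply/eqP=> /n_head; rewrite fn eqxx.
pose AA (i : bool) := if i then A' else A.
have AA_closed i : closed_off n (AA i) by case: i.
have A_A' m : m \in A' -> m \notin A by rewrite inE => /andP[].
have prem_f e : tail e \in A' -> head e = n -> e = f.
  move=> /A_A' eA en; have := n_prems e; rewrite !inE en eqxx.
  by case: eqP => [ea|_ /esym/eqP //]; rewrite ea aA in eA.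
have [E EP] : exists E : extension (R := PStruct b) n
    (fun i => sub_pstruct (AA_closed i) b), forall i e, ext_arc E (i := i) e = val e.
  apply: sub_extension => //.
    by case=> -[] // m; [move/A_A'/negbTE-> | move=> mA /A_A'; rewrite mA].
  move=> m; have [mA|mA] := boolP (m \in A); first by constructor 3; exists false.
  have [->|mn] := eqVneq m n; first by constructor 1.
  have [mA'|] := boolP (m \in A'); first by constructor 3; exists true.
  rewrite inE mA mn /= negb_forall => /existsP[e].
  by rewrite negb_imply negbK => /andP[/eqP en /eqP em]; constructor 2; exists e.
apply: (@Sequential (PStruct b) n); first exact: boxes_proof_structure.
apply: (seq_binary (R := PStruct b) (E := E) nl) => i.
  suff [e0 [e0A e0n e0P]] : exists e0, [/\ tail e0 \in AA i, head e0 = n &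
      forall e, tail e \in AA i -> head e = n -> e = e0].
    pose e0' : arc (sub_pstruct (AA_closed i) b) := exist (fun e => tail e \in AA i) e0 e0A.
    rewrite -(cards1 e0').
    congr #|pred_of_set _|; apply/setP=> e; rewrite !inE EP -val_eqE /=.
    by apply/eqP/eqP => [|->//]; apply: e0P; apply: (valP e).
  case: i; last by exists a.
  by exists f.
have fA : tail f \notin AA false by apply: A_A'.
case: i; last first.
  apply: (sub_sequential (AA_closed false) fA aA) => e eA.
  have [->|ea] := eqVneq e a; first by rewrite ao an !eqxx.
  apply/negbTE; apply/andP=> -[eo]; case/orP=> [/eqP en|el].
    by rewrite (A_prem _ eA en) eqxx in ea.
  by have := A_goal _ eA; rewrite /goal_arc eo el.
have aA' : tail a \notin AA true by apply: contraL aA; apply: A_A'.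
have gA : tail g \notin A by have := A_goal g; rewrite gP eqxx; case: (_ \in _) => // /(_ isT).
(* Two output premises force a tensor node with output conclusion. That conclusion is [g], and [f]
   replaces it as goal arc. *)
have [fo|/eqP fi] := eqVneq (p f) Output.
  have not_one_input : #|inputs p (prems n)| <> 1.
    rewrite (_ : inputs p _ = set0) ?cards0 //; apply/setP=> e; rewrite !inE.
    have := n_prems e; rewrite !inE => ->.
    by apply/negbTE; apply/andP=> -[/orP[]/eqP->]; rewrite ?ao ?fo.
  have [c /eqP cn co] : exists2 c, tail c == n & p c = Output.
    have := p_pol n; have := labP n; case: nl => -> /=; first by move=> _ [].
    move=> /andP[_ /eqP n1] [[_ h]|[]//].
    have /cards1P[c cP] : #|concls n| == 1 by rewrite n1.
    have : c \in concls n by rewrite cP inE.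
    by move=> cn; exists c; [move: cn; rewrite inE | apply: h].
  have cg : c = g by apply/eqP; rewrite -gP /goal_arc co n_term // !inE.
  apply: (sub_sequential (AA_closed true) aA' fA') => e eA.
  have [->|ef] := eqVneq e f; first by rewrite fo fn !eqxx.
  apply/negbTE; apply/andP=> -[eo]; case/orP=> [/eqP en|el].
    by rewrite (prem_f _ eA en) eqxx in ef.
  have : goal_arc p e by rewrite /goal_arc eo el.
  by rewrite gP -cg => /eqP ec; move: (eA : tail e \in A'); rewrite A'P ec cn eqxx andbF.
(* Since [f] is input, [n] has no output conclusion, so [g] survives in the other half. *)
have gn : tail g != n.
  apply/eqP=> gn; have gc : g \in concls n by rewrite inE gn.
  have /andP[/eqP go _] : goal_arc p g by rewrite gP.
  have := p_pol n; have := labP n; case: nl => -> /=.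
    by rewrite cards_eq0 => /andP[_ /eqP n0]; rewrite n0 inE in gc.
  move=> _ [] [h1 h2]; last by rewrite h2 in go.
  by apply: fi; apply: h1; rewrite inE fn.
have gA' : tail g \in A' by rewrite A'P gA.
apply: (sub_sequential (AA_closed true) aA' gA') => e eA.
rewrite -gP /goal_arc; case: (head e =P n) => //= /(prem_f _ eA) ->.
by case: eqP fi.
Qed.

(** * Good nodes and splitting at a node of minimal rank *)

Definition io_tail (e : arc G) : node G := if p e == Input then head e else tail e.
Definition io_head (e : arc G) : node G := if p e == Input then tail e else head e.

(** Good nodes have at most one outgoing edge in G^{i/o}. *)
Definition good (x : node G) : bool :=
  match lab x with
  | Ax | One | Bang | Bullet => true
  | Tensor => [forall e in prems x, p e == Output]
  | _ => false
  end.

Definition lower (x : node G) : bool := lab x \in [:: Par; Der; Whynot; Bot].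

(** Under polarization, these are the cut nodes and the tensor nodes with input conclusion. *)
Definition cutlike (x : node G) : bool :=
  (lab x \in [:: Cut; Tensor]) && [exists e in prems x, p e == Input].

Lemma good_cutlike_lower x : [|| good x, cutlike x | lower x].
Proof.
have [p_pol _ _ _] := p_correct; have := p_pol x.
rewrite /good /cutlike /lower; case: (lab x) => //=.
  case=> /eqP/cards1P[e eP] _; suff ->: [exists e in prems x, p e == Input] by [].
  have : e \in inputs p (prems x) by rewrite eP inE.
  by rewrite inE => /andP[ex ei]; apply/exists_inP; exists e.
move=> _; case: forall_inP => //= H; rewrite orbF; apply/exists_inP.
case: (boolP [exists e in prems x, p e == Input]) => [/exists_inP//|/exists_inP h].
by case: H => e ex; apply/eqP/outputE => ei; apply: h; exists e; rewrite ?ei.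
Qed.

Lemma good_input_prem (e : arc G) : good (head e) -> p e = Input -> lab (head e) = Bullet.
Proof.
have ee : e \in prems (head e) by rewrite inE.
rewrite /good => + ei; have := labP (head e); case: (lab _) => //=.
- by rewrite cards_eq0 => /andP[/eqP e0]; rewrite e0 inE in ee.
- by rewrite cards_eq0 => /andP[/eqP e0]; rewrite e0 inE in ee.
- by move=> _ /forall_inP/(_ e ee); rewrite ei.
- by rewrite cards_eq0 => /andP[/eqP e0]; rewrite e0 inE in ee.
Qed.

(** The outgoing edges of a node are its input premises and output conclusions. A good node has at
    most one: the output conclusion of an ax, 1 or tensor node, the principal port of a ! node, or
    the premise of a bullet if it is input. *)
Lemma good_out_unique (e f : arc G) :
  good (io_tail e) -> io_tail f = io_tail e -> e = f.
Proof.
have [p_pol _ _ _] := p_correct.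
pose out x := inputs p (prems x) :|: outputs p (concls x).
have outP (a : arc G) : a \in out (io_tail a).
  by rewrite /io_tail !inE; case: (p a =P Input) => [->|/outputE->]; rewrite !eqxx ?orbT.
move=> x_good fe; have {outP} [eo fo] := (outP e, outP f); move: eo fo x_good; rewrite fe.
move: (io_tail e) => x {fe} eo fo x_good; suff : #|out x| <= 1 by move/card_le1_eqP; apply.
have in0 : #|prems x| = 0 -> out x = outputs p (concls x).
  by move/eqP; rewrite cards_eq0 => /eqP x0; apply/setP=> a; rewrite !(inE, x0).
have out_sub : outputs p (concls x) \subset concls x by apply/subsetP=> a; rewrite inE => /andP[].
have in_sub : inputs p (prems x) \subset prems x by apply/subsetP=> a; rewrite inE => /andP[].
have := labP x; have := p_pol x; move: x_good; rewrite /good.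
case x_lab: (lab x) => //= H.
- by case=> _ x_out /andP[/eqP/in0-> _]; rewrite x_out.
- by move=> _ /andP[/eqP/in0-> /eqP<-]; apply: subset_leq_card.
- move=> _ /andP[_ /eqP<-]; apply: subset_leq_card; rewrite /out.
  rewrite (_ : inputs p _ = set0) ?set0U //; apply/setP=> a; rewrite !inE.
  apply/negbTE; apply/andP=> -[ax /eqP ai]; move/forall_inP: H => /(_ a).
  by rewrite inE ax ai => /(_ isT).
- move=> x_pol /andP[/eqP/in0-> _]; apply/card_le1_eqP => a c.
  rewrite !inE => /andP[ax ao] /andP[cx co].
  have [xa xc] : a \in concls x /\ c \in concls x by rewrite !inE.
  have := x_pol _ xa; have := x_pol _ xc; rewrite (eqP ao) (eqP co).
  case: ifP => // /andP[_ /forall_inP hc] _; case: ifP => // /andP[_ /forall_inP ha] _.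
  have [_ anti _ _] := bang_leP x_lab.
  by apply: anti => //; rewrite ha // hc.
- move=> _ /andP[/eqP<- /eqP x0]; apply: subset_leq_card.
  rewrite /out (_ : outputs p _ = set0) ?setU0 //; apply/eqP.
  by rewrite -subset0; apply: (subset_trans out_sub); rewrite subset0 -cards_eq0 x0.
Qed.

Variable r : node G -> nat.
Hypothesis r_lt : forall e : arc G, r (io_tail e) < r (io_head e).

(** Take for [A] the nodes from which [tail a] can be reached in the reoriented graph. They have
    smaller rank than [n], hence are good. *)
Lemma sequential_split (n : node G) (a : arc G) :
  (forall x, r x < r n -> good x) ->
  lab n = Cut \/ lab n = Tensor ->
  (forall e : arc G, tail e = n -> lab (head e) = Bullet) ->
  head a = n -> p a = Output -> sequential (PStruct b).
Proof.
move=> n_good nl n_term an ao.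
pose arrow x y := [exists e : arc G, (io_tail e == x) && (io_head e == y)].
pose A := [set x | connect arrow x (tail a)].
have ta : tail a = io_tail a by rewrite /io_tail ao.
have ha : io_head a = n by rewrite /io_head ao.
have r_connect x y : connect arrow x y -> r x <= r y.
  case/connectP=> q; elim: q x => [|z q IHq] x /=; first by move=> _ ->.
  case/andP=> /existsP[e /andP[/eqP<- /eqP ez]] qz yz.
  by apply: leq_trans (IHq _ qz yz); rewrite -ez ltnW.
have rA x : x \in A -> r x < r n.
  by rewrite inE => /r_connect /leq_ltn_trans; apply; rewrite ta -ha.
have A_good x : x \in A -> good x by move/rA/n_good.
have A_tail e : io_head e \in A -> io_tail e \in A.
  rewrite !inE; apply: connect_trans; apply: connect1; apply/existsP; exists e.
  by rewrite !eqxx.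
(* A path from [io_tail e] to [tail a] must begin with [e], the only outgoing edge; if the path is
   empty, that edge is [a]. *)
have A_head e : io_tail e \in A -> e = a \/ io_head e \in A.
  move=> eA; have e_good := A_good _ eA.
  move: eA; rewrite inE => /connectP[[|y q] /=].
    by rewrite ta => _ /(good_out_unique e_good); left.
  case/andP=> /existsP[f /andP[/eqP fe /eqP fy]] qy ya; right.
  rewrite (good_out_unique e_good fe) fy inE; apply/connectP; exists q => //.
have nA : n \notin A by apply/negP=> /rA; rewrite ltnn.
have aA : tail a \in A by rewrite inE connect0.
have A_closed : closed_off n A.
  split=> // e; have := A_tail e; have := A_head e; rewrite /io_head /io_tail.
    by case: ifP => _ h1 h2 h; [rewrite h2|case: (h1 h) => [->|->//]; rewrite an eqxx orbT].
  case: ifP => _ h1 h2 h; last exact: h2.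
  by case: (h1 h) => // ea; rewrite ea an (negbTE nA) in h.
apply: (sequential_binary nl n_term A_closed an ao aA) => e eA.
  move=> en; have := A_tail e; have := A_head e; rewrite /io_head /io_tail en.
  case: ifP => _ h1 h2; first by have := h2 eA; rewrite (negbTE nA).
  by case: (h1 eA) => // /idPn; rewrite nA.
(* A goal arc starting in [A] would end in a bullet of [A]. Its premise being output, this bullet
   has no outgoing edge and cannot reach [tail a]. *)
apply/negP=> /andP[/eqP eo el].
have e_tail : io_tail e = tail e by rewrite /io_tail eo.
have e_head : io_head e = head e by rewrite /io_head eo.
have eA' : io_tail e \in A by rewrite e_tail.
have [ea|] := A_head e eA'.
  by move: el; rewrite ea an; case: nl => ->.
rewrite e_head => hA; have hg := A_good _ hA.
have hb : lab (head e) = Bullet.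
  by move: el hg; rewrite /good; case: (lab _).
move: hA; rewrite inE => /connectP[[|y q] /=].
  by move=> _ ae; apply: (tail_bullet (e := a)); rewrite ae.
case/andP=> /existsP[f /andP[/eqP fe _]] _ _; move: fe; rewrite /io_tail.
case: eqP => [fi|_] fe; last by apply: (tail_bullet (e := f)); rewrite fe.
by move: fi; rewrite (bullet_prem hb fe) eo.
Qed.

(** The situation in which no lower node can be removed. *)
Hypothesis no_par_o : forall x, ~~ par_o p x.
Hypothesis not_lower : forall e : arc G, lower (tail e) -> lab (head e) <> Bullet.

Lemma lower_concl x : lower x -> exists2 e : arc G, tail e = x & p e = Input.
Proof.
have [p_pol _ _ _] := p_correct.
rewrite /lower => xl; have /cards1P[e eP] : #|concls x| == 1.
  by have := labP x; case: (lab x) xl => //= _ /andP[_].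
have ex : e \in concls x by rewrite eP inE.
exists e; first by move: ex; rewrite inE => /eqP.
have := no_par_o x; rewrite /par_o; have := p_pol x; case: (lab x) xl => //= _.
- by move=> h _; apply: h.
- case=> -[_ h]; first by move=> _; apply: h.
  by rewrite negb_exists => /forallP/(_ e); rewrite ex h.
- by move=> h _; apply: h.
- by case=> _ h _; apply: h.
Qed.

(** Induction on the rank. The input conclusion of a lower node leads to a node of smaller rank,
    which is good and so must be a bullet, against [not_lower]. *)
Lemma good_below N : (forall y, r y < N -> ~~ cutlike y) -> forall x, r x < N -> good x.
Proof.
move=> N_cut x; have [k] := ubnP (r x); elim: k x => // k IHk x xk xN.
have := good_cutlike_lower x; rewrite (negbTE (N_cut _ xN)) /=; case/orP=> // xl.
have [e ex ei] := lower_concl xl.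
have := r_lt e; rewrite /io_tail /io_head ei /= ex => rx.
case: (not_lower (e := e)); rewrite ?ex //.
by apply: good_input_prem ei; apply: IHk; [apply: leq_trans rx xk | apply: ltn_trans rx xN].
Qed.

Lemma sequential_cutlike x : cutlike x -> sequential (PStruct b).
Proof.
move=> x_cut; have [p_pol _ _ _] := p_correct.
case: (arg_minnP r x_cut) => n n_cut n_min.
have n_good x' : r x' < r n -> good x'.
  apply: good_below => y; rewrite ltnNge; exact/contra/n_min.
case/andP: n_cut => nl /exists_inP[i i_n /eqP ii].
have nl' : lab n = Cut \/ lab n = Tensor.
  by case: (lab n) nl => //; [left | right].
have n_pol : #|inputs p (prems n)| = 1 /\ {in concls n, forall e, p e = Input}.
  have := p_pol n; have := labP n; case: nl' => -> /=.
    rewrite cards_eq0 => /andP[_ /eqP n0] [n1 _]; split=> // e.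
    by rewrite n0 inE.
  by move=> _ [[/(_ _ i_n)]|//]; rewrite ii.
have n2 : #|prems n| = 2 by have := labP n; case: nl' => -> /andP[/eqP].
have [i' [o [_ oo n_prems]]] := one_input n2 n_pol.1.
have /eqP on : head o == n.
  by have /setP/(_ o) := n_prems; rewrite !inE eqxx orbT.
(* A conclusion of [n] is input, so its head has smaller rank and is good; a good node with an input
   premise is a bullet. *)
apply: (sequential_split n_good nl' _ on oo) => e en.
have ei : p e = Input by apply: n_pol.2; rewrite inE en.
apply: good_input_prem (ei); apply: n_good.
by have := r_lt e; rewrite /io_tail /io_head ei /= en.
Qed.

(** For a ! node this is the principal port, which exists as the greatest element of a nonempty
    finite total order. *)
Lemma good_output_concl x : good x -> lab x <> Bullet ->
  exists2 e : arc G, tail e = x & p e = Output.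
Proof.
have [p_pol _ _ _] := p_correct; have x_pol := p_pol x; have xP := labP x.
suff conclP : good x -> lab x <> Bullet -> exists2 e : arc G, e \in concls x & p e = Output.
  by move=> xg xb; have [e + eo] := conclP xg xb; rewrite inE => /eqP; exists e.
have some_concl : 0 < #|concls x| -> {in concls x, forall e, p e = Output} ->
    exists2 e : arc G, e \in concls x & p e = Output.
  by case/card_gt0P=> e ex h; exists e; last exact: h.
move: x_pol xP; rewrite /good; case x_lab: (lab x) => //=.
- move=> [_ /eqP/cards1P[e eP]] _ _ _; have : e \in outputs p (concls x) by rewrite eP inE.
  by rewrite inE => /andP[ex /eqP]; exists e.
- by move=> h /andP[_ /eqP x1] _ _; apply: some_concl h; rewrite x1.
- move=> + /andP[_ /eqP x1] /forall_inP xg _; case=> [[_ h]|[x_in _]].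
    by apply: some_concl h; rewrite x1.
  have /cards1P[e eP] : #|inputs p (prems x)| == 1 by rewrite x_in.
  have : e \in inputs p (prems x) by rewrite eP inE.
  by rewrite inE => /andP[/xg/eqP->].
- move=> h /andP[_ /card_gt0P x0] _ _.
  have [e ex e_max] := total_order_max (bang_leP x_lab) x0.
  exists e => //; rewrite h // /principal ex /=.
  by case: forall_inP.
Qed.

Lemma sequential_all_good : (forall x, good x) -> sequential (PStruct b).
Proof.
move=> all_good; have [p_pol _ _ [g gP]] := p_correct; set n := tail g.
have /andP[/eqP go gl] : goal_arc p g by rewrite gP.
have gb : lab (head g) = Bullet.
  by have := all_good (head g); move: gl; rewrite /good; case: (lab _).
have nb : lab n <> Bullet by apply: tail_bullet.
have [nt|nt] := eqVneq (lab n) Tensor.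
  have n2 : #|prems n| = 2 by have := labP n; rewrite nt => /andP[/eqP].
  have [a an] : exists a, a \in prems n by apply/card_gt0P; rewrite n2.
  apply: (@sequential_split n a) => //; first by right.
  - move=> e en; rewrite (_ : e = g) //; apply: concl_unique en.
    by rewrite -/n nt.
  - by move: an; rewrite inE => /eqP.
  - have := all_good n; rewrite /good nt => /forall_inP h; exact/eqP/h.
have n_label : [\/ lab n = Ax, lab n = One | lab n = Bang].
  by have := all_good n; move: nt nb; rewrite /good; case: (lab n) => // *; constructor.
have n_prems (e : arc G) : head e <> n.
  move=> en; have: #|prems n| = 0 by have := labP n; case: n_label => -> /andP[/eqP].
  by move/eqP; rewrite cards_eq0 => /eqP/setP/(_ e); rewrite !inE en eqxx.
(* Following output conclusions raises the rank, so the walk ends in a bullet, and its last arc is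
   [g], leaving from [n]. As [n] has no premises, the walk already started at [n]. *)
have to_n x : lab x <> Bullet -> x = n.
  pose M := \max_y r y; have rM y : r y <= M by apply: leq_bigmax.
  have [k] := ubnP (M - r x); elim: k x => // k IHk x xk xb.
  have [e ex eo] := good_output_concl (all_good x) xb.
  have := r_lt e; rewrite /io_tail /io_head eo /= ex => rx.
  have [hb|/eqP hb] := eqVneq (lab (head e)) Bullet.
    have : goal_arc p e by rewrite /goal_arc eo hb !inE.
    by rewrite gP => /eqP eg; rewrite -ex eg.
  case: (n_prems e); apply: IHk hb.
  by apply: leq_trans (ltn_sub2l (leq_trans rx (rM _)) rx) _.
have n_only : only (G := PStruct b) n.
  have arc_n (e : arc G) : tail e = n by apply/to_n/tail_bullet.
  split=> [//|m]; have [mb|/eqP/to_n] := eqVneq (lab m) Bullet; last by left.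
  right; split=> //; have := labP m; rewrite mb => /andP[/cards1P[e eP] _].
  have : e \in prems m by rewrite eP inE.
  by rewrite inE => /eqP; exists e.
apply: (@Sequential (PStruct b) n); first exact: boxes_proof_structure.
case: n_label => n_lab.
- by apply: seq_axiom; first left.
- by apply: seq_axiom; first right.
have /eqP n_lab' := n_lab.
apply: (@seq_box (PStruct b) (exist (fun m => lab m == Bang) n n_lab')) => //.
exact: (b_boxes _).2.
Qed.

End Step.

(** * Induction on the arcs, then on the boxes *)

(** With the boxes already sequential, it suffices to count the arcs of the ground-structure
    itself. *)
Lemma sequential_ground (G : ground) (b : bang G -> pstruct) (p : arc G -> polarity) :
  correct p ->
  (forall m : bang G, #|conclusions (b m)| = #|concls (val m)| /\ sequential (b m)) ->
  sequential (PStruct b).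
Proof.
have [k] := ubnP #|arc G|; elim: k G b p => // k IHk G b p Gk p_correct b_boxes.
have IH (G' : ground) (b' : bang G' -> pstruct) (p' : arc G' -> polarity) :
    #|arc G'| < #|arc G| -> correct p' ->
    (forall m : bang G', #|conclusions (b' m)| = #|concls (val m)| /\ sequential (b' m)) ->
    sequential (PStruct b').
  by move=> G'G; apply: IHk; apply: leq_trans G'G _.
have [c /andP[cl /eqP cb]|no_terminal] := pickP (fun c : arc G =>
    lower (tail c) && (lab (head c) == Bullet)).
  exact: (sequential_unary p_correct b_boxes IH cl cb).
have not_lower (e : arc G) : lower (tail e) -> lab (head e) <> Bullet.
  by move=> el /eqP eb; have := no_terminal e; rewrite /= el eb.
have [p_pol p_term [r r_lt] _] := p_correct.
(* The conclusion of a par_o node of maximal rank is output, hence kept, and cannot lead to another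
   par_o node. By terminality it leads to a bullet, against [not_lower]. *)
have no_par_o x : ~~ par_o p x.
  apply/negP=> x_par; case: (arg_maxnP r x_par) => m m_par m_max.
  have [ml /exists_inP[e em eo]] := andP m_par; move: em; rewrite inE => /eqP em.
  have := p_term e; rewrite em => /(_ m_par)[e_par|].
    have := r_lt e; rewrite /io_kept (eqP eo) andbF => /(_ isT) /=.
    by rewrite em ltnNge => /negP; apply; apply: m_max.
  by apply: not_lower; rewrite em /lower inE ml.
(* Without par_o nodes no arc is erased, so the rank increases along every arc. *)
have {}r_lt (e : arc G) : r (io_tail p e) < r (io_head p e).
  have := r_lt e; rewrite /io_kept (negbTE (no_par_o _)) => /(_ isT).
  by rewrite /io_tail /io_head; case: ifP.
have [x x_cut|no_cut] := pickP (cutlike p).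
  exact: (sequential_cutlike p_correct b_boxes IH r_lt no_par_o not_lower x_cut).
apply: (sequential_all_good p_correct b_boxes IH r_lt) => x.
apply: (good_below p_correct r_lt no_par_o not_lower) (ltnSn _) => y _.
by rewrite no_cut.
Qed.

Theorem proposition20 (R : pstruct) (p : all_arcs R -> polarity)
  (R_ps : proof_structure R) (R_pol : polarized p)
  (R_term : par_o_terminal p) (R_ACC : ACC p) : sequential R.
Proof.
(* Induction on the nesting of boxes, which makes all boxes sequential before the ground-structure
   is treated. *)
elim: R p R_ps R_pol R_term R_ACC => G b IHb p b_ps [G_pol b_pol] [G_term b_term] [G_ACC b_ACC].
apply: (sequential_ground (p := fun e => p (inl e))).
  by split=> //; [apply: ACC_ranked | apply: ACC_intuitionistic].
move=> m; have [bm m_ps] := b_ps m; split=> //.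
exact: (IHb m _ m_ps (b_pol m) (b_term m) (b_ACC m)).
Qed.
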